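(* Let $X$ be a finite dimensional smooth and strictly convex real normed linear space with $\dim X\geq 3$. Then $X$ is an inner product space (i.e. its norm is induced by an inner product) if and only if for every element $x_0\in X$ and every one dimensional subspace $G$ of $X$, the best coapproximation to $x_0$ out of $G$ exists and is equal to the best approximation to $x_0$ out of $G$.
   Context: Let $x_0\in X$ and let $G$ be a linear subspace of $X$. An element $g_0\in G$ is a best approximation to $x_0$ out of $G$ if $\|x_0-g_0\|\leq\|x_0-g\|$ for all $g\in G$. An element $w_0\in G$ is a best coapproximation to $x_0$ out of $G$ if $\|w_0-g\|\leq\|x_0-g\|$ for all $g\in G$. *)

(* Defs.v *)
From HB Require Import structures.
From mathcomp Require Import all_boot all_order all_algebra.
From mathcomp Require Import boolp classical_sets reals topology normedtype.

Set Implicit Arguments.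
Unset Strict Implicit.
Unset Printing Implicit Defensive.

Import Order.TTheory GRing.Theory Num.Theory.
Import numFieldNormedType.Exports.

Local Open Scope classical_set_scope.
Local Open Scope ring_scope.

(* Finite dimensional normed spaces: a Vector structure provides
   finite dimension, [{vspace X}] and [\dim]. *)
#[short(type="normedVectType")]
HB.structure Definition NormedVector (K : numFieldType) :=
  {V of NormedModule K V & Vector K V}.

Section Defs.
Variables (R : realType) (X : normedVectType R).

(* [sup] of an unbounded set is 0, so [dual_norm f = 1] entails boundedness. *)
Definition dual_norm (f : {scalar X}) : R :=
  sup [set `|f y| | y in [set y : X | `|y| <= 1]].

Definition norming (x : X) (f : {scalar X}) : Prop :=
  dual_norm f = 1 /\ f x = `|x|.

Definition smooth : Prop :=
  forall x : X, x != 0 -> exists! f : {scalar X}, norming x f.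

Definition strictly_convex : Prop :=
  forall x y : X, `|x| = 1 -> `|y| = 1 -> x != y ->
  forall t : R, 0 < t < 1 -> `|(1 - t) *: x + t *: y| < 1.

(* [{dot X for idfun}]: real symmetric positive definite bilinear forms. *)
Definition inner_product_space : Prop :=
  exists B : {dot X for idfun}, forall x : X, `|x| = Num.sqrt (B x x).

Definition best_approximation (x0 : X) (G : {vspace X}) : set X :=
  [set g0 | g0 \in G /\ forall g, g \in G -> `|x0 - g0| <= `|x0 - g|].

Definition best_coapproximation (x0 : X) (G : {vspace X}) : set X :=
  [set w0 | w0 \in G /\ forall g, g \in G -> `|w0 - g| <= `|x0 - g|].

End Defs.

Arguments smooth {R} X.
Arguments strictly_convex {R} X.
Arguments inner_product_space {R} X.

(* Main.v *)
(* In an inner product space both approximations are the orthogonal projection.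

   Conversely, the two approximations of a point out of a line coincide exactly
   when Birkhoff-James orthogonality is symmetric.  Let [J x] be [`|x|] times
   the norming functional at [x]; then [J x y = 0] iff [J y x = 0], and
   [B x y := J x y] is an inner product as soon as it is symmetric.  For
   pairwise orthogonal [u], [v], [w], let [slope u v t] be the ratio of
   [J (u + t v) v] to [J (u + t v) u].  Comparing the functionals at
   [u + s v + s t w] in the three coordinate planes gives
   [slope u w (s t) = slope u v s * slope v w t], so that
   [m t := slope u v t / slope u v 1] is multiplicative; symmetry of
   orthogonality makes [m] an involution, and [J x y <= `|x| * `|y|] makes it
   nondecreasing, hence [m] is the identity on the positive reals.  Thus, with
   [k := slope u v 1], [J (u + t v)] is proportional to
   [J u + k t J v] and the same bound forces [`|u + t v|^2 / (1 + k t^2)] to be constant in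
   [t].  For unit vectors this gives [k = 1], and the symmetry of [J]. *)
Require Import Defs.
From HB Require Import structures.
From mathcomp Require Import all_boot all_order all_algebra.
From mathcomp Require Import boolp classical_sets reals topology normedtype.
From mathcomp Require Import ring lra.
Import Order.TTheory GRing.Theory Num.Theory.
Import numFieldNormedType.Exports.
Local Open Scope classical_set_scope.
Local Open Scope ring_scope.

Set Implicit Arguments.
Unset Strict Implicit.

(* Cut [[0, T]] into [n] equal pieces: the increments add up to at most
   [C * T ^+ 2 / n]. *)
Lemma eq_of_dist_le_sqr (R : realType) (F : R -> R) (C T : R) : 0 <= T ->
  (forall s t, 0 <= s <= T -> 0 <= t <= T -> F t - F s <= C * (t - s) ^+ 2) ->
  F T = F 0.
Proof.
move=> T0 FC; apply/eqP; rewrite -subr_eq0 -normr_le0 leNgt; apply/negP => e0.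
set e := `|F T - F 0| in e0.
have FCn a b : 0 <= a <= T -> 0 <= b <= T -> `|F b - F a| <= C * (b - a) ^+ 2.
  move=> aT bT; rewrite ler_norml FC// andbT lerNl opprB.
  by rewrite -sqrrN opprB FC.
have C0 : 0 <= C * T ^+ 2 / e.
  rewrite divr_ge0 ?(ltW e0)//; apply: le_trans (normr_ge0 (F T - F 0)) _.
  by rewrite -[X in C * X ^+ 2]subr0 FCn ?lexx ?T0.
pose n := Num.bound (C * T ^+ 2 / e).
have nlt : C * T ^+ 2 / e < n%:R by rewrite archi_boundP.
have n0 : 0 < n%:R :> R by apply: le_lt_trans nlt.
pose d := T / n%:R.
have d0 : 0 <= d by rewrite divr_ge0// ltW.
have step i : (i <= n)%N -> `|F (d * i%:R) - F 0| <= C * d ^+ 2 * i%:R.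
  elim: i => [_|i IH lin]; first by rewrite mulr0 subrr normr0 mulr0.
  have mem j : (j <= n)%N -> 0 <= d * j%:R <= T.
    move=> jn; rewrite mulr_ge0 ?ler0n//= /d mulrAC ler_pdivrMr//.
    by rewrite ler_wpM2l// ler_nat.
  rewrite -(subrKA (F (d * i%:R))); apply: le_trans (ler_normD _ _) _.
  have -> : C * d ^+ 2 * i.+1%:R = C * d ^+ 2 + C * d ^+ 2 * i%:R.
    by rewrite -natr1; ring.
  rewrite lerD ?IH// 1?ltnW//.
  have -> : d ^+ 2 = (d * i.+1%:R - d * i%:R) ^+ 2 by rewrite -natr1; ring.
  by rewrite FCn ?mem// ltnW.
have := step n (leqnn n); rewrite /d mulfVK ?gt_eqF//.
have -> : C * (T / n%:R) ^+ 2 * n%:R = C * T ^+ 2 / n%:R by field; rewrite gt_eqF.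
by rewrite -/e ler_pdivlMr// mulrC leNgt -ltr_pdivrMr ?nlt.
Qed.


Lemma dot_of_scalar (R : realType) (X : lmodType R) (J : X -> {scalar X}) :
  (forall x y, J x y = J y x) -> (forall x, x != 0 -> 0 < J x x) ->
  exists B : {dot X for idfun}, forall x y, B x y = J x y.
Proof.
move=> Jsym Jpos; pose B x y := J x y.
have Bl : bilinear_for *%R *%R B.
  split=> y a x z; rewrite /B; last exact: linearP.
  by rewrite /= ![J _ y]Jsym linearP.
pose H1 := bilinear_isBilinear.Build R X X R *%R (idfun \; *%R) B Bl.
have Bh x y : B x y = (-1) ^+ false * idfun (B y x) by rewrite mul1r /B Jsym.
pose H2 := isHermitianSesquilinear.Build R X false idfun B Bh.
pose H3 := isDotProduct.Build R X B Jpos.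
by exists (HB.pack_for {dot X for idfun} B H1 H2 H3).
Qed.

(** * Duality maps with symmetric orthogonality *)

Section DualityMap.
Variables (R : realType) (X : normedVectType R) (J : X -> {scalar X}).
Hypothesis Jxx : forall x, J x x = `|x| ^+ 2.
Hypothesis J_le : forall x y, J x y <= `|x| * `|y|.
Hypothesis J_sym0 : forall x y, J x y = 0 -> J y x = 0.
Implicit Types (x y z u v : X) (s t : R).

Lemma JrZ x c y : J x (c *: y) = c * J x y.
Proof. by rewrite linearZ. Qed.

Lemma J0 y : J 0 y = 0.
Proof.
apply/eqP; rewrite eq_le.
have := J_le 0 y; have := J_le 0 (- y).
by rewrite linearN normr0 !mul0r oppr_le0 => -> ->.
Qed.

(** The component [z] of [y] in the kernel of [J x] satisfies [J z x = 0], hence [J z (c *: x) = 0];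
    symmetry returns [J (c *: x) z = 0], so only the value at [x] remains. *)
Lemma JZ c x y : J (c *: x) y = c * J x y.
Proof.
have [->|c0] := eqVneq c 0; first by rewrite scale0r J0 mul0r.
have [->|x0] := eqVneq x 0; first by rewrite scaler0 J0 mulr0.
have nx0 : `|x| != 0 by rewrite normr_eq0.
have cx : J (c *: x) x = c * `|x| ^+ 2.
  have := Jxx (c *: x); rewrite linearZ /= normrZ exprMn real_normK ?num_real//.
  by rewrite expr2 -mulrA => /(mulfI c0).
pose z := y - (J x y / `|x| ^+ 2) *: x.
have /J_sym0 zx : J x z = 0.
  by rewrite linearB linearZ /= Jxx divfK ?subrr// expf_neq0.
have /J_sym0 : J z (c *: x) = 0 by rewrite linearZ /= zx mulr0.
rewrite linearB linearZ /= cx => /eqP; rewrite subr_eq0 => /eqP ->.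
by field.
Qed.

Lemma J_monotone x y : 0 <= J x (x - y) - J y (x - y).
Proof.
rewrite !linearB /= !Jxx.
have := J_le x y; have := J_le y x; have := sqr_ge0 (`|x| - `|y|).
nra.
Qed.

(** Monotonicity between [u + v] and [v] gives the weak inequality. If the value were 0, symmetry
    would make [J u (u + v)], the squared norm of [u], vanish. *)
Lemma J_proj_gt0 u v : u != 0 -> J u v = 0 -> 0 < J (u + v) u.
Proof.
move=> u0 uv; rewrite lt_def; apply/andP; split; last first.
  by have := J_monotone (u + v) v; rewrite addrK (J_sym0 uv) subr0.
apply/eqP => /J_sym0; rewrite linearD /= uv addr0 Jxx => /eqP.
by rewrite expf_eq0 normr_eq0 (negPf u0).
Qed.

(** * Slopes in the plane of two orthogonal vectors *)

Definition slope u v t := J (u + t *: v) v / J (u + t *: v) u.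

Section Plane.
Variables (u v : X).
Hypotheses (u0 : u != 0) (v0 : v != 0) (uv : J u v = 0).

Lemma slope_den_gt0 t : 0 < J (u + t *: v) u.
Proof. by apply: J_proj_gt0 => //; rewrite linearZ /= uv mulr0. Qed.

Lemma slope_num_gt0 t : 0 < t -> 0 < J (u + t *: v) v.
Proof.
move=> t0; rewrite -(pmulr_rgt0 _ t0).
have -> : t * J (u + t *: v) v = J (u + t *: v) (t *: v).
  by rewrite linearZ.
rewrite addrC J_proj_gt0 ?scaler_eq0 ?negb_or ?v0 ?gt_eqF//.
by rewrite JZ (J_sym0 uv) mulr0.
Qed.

Lemma slope_gt0 t : 0 < t -> 0 < slope u v t.
Proof. by move=> t0; rewrite divr_gt0 ?slope_den_gt0 ?slope_num_gt0. Qed.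

(* Multiply the bounds [J x y <= `|x| * `|y|] and [J y x <= `|x| * `|y|] for
   [x := u + s v] and [y := u + t v], and expand. *)
Lemma slope_le s t : 0 < s -> s <= t -> slope u v s <= slope u v t.
Proof.
move=> s0; rewrite le_eqVlt => /predU1P[->//|st].
have t0 := lt_trans s0 st.
set x := u + s *: v; set y := u + t *: v.
rewrite /slope -/x -/y ler_pdivrMr ?slope_den_gt0// mulrAC ler_pdivlMr ?slope_den_gt0//.
have lin z r : J z u + r * J z v = J z (u + r *: v) by rewrite linearD linearZ.
have E1 : J x u + s * J x v = `|x| ^+ 2 by rewrite lin Jxx.
have E2 : J y u + t * J y v = `|y| ^+ 2 by rewrite lin Jxx.
have E3 : J x u + t * J x v <= `|x| * `|y| by rewrite lin J_le.
have E4 : J y u + s * J y v <= `|x| * `|y| by rewrite lin mulrC J_le.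
have p0 := slope_den_gt0 s; have p0' := slope_den_gt0 t.
have q0 := slope_num_gt0 s0; have q0' := slope_num_gt0 t0.
move: p0 q0 p0' q0' E1 E2 E3 E4; rewrite -/x -/y.
move: (J x u) (J x v) (J y u) (J y v) `|x| `|y| => p q p' q' a b p0 q0 p0' q0' E1 E2 E3 E4.
have H : (p' + s * q') * (p + t * q) <= (p + s * q) * (p' + t * q').
  rewrite E1 E2 -exprMn expr2 ler_pM// ltW// addr_gt0// mulr_gt0//.
have : (t - s) * (p' * q) <= (t - s) * (p * q') by nra.
by rewrite ler_pM2l ?subr_gt0// => ?; nra.
Qed.

Lemma slopeN0 t : t != 0 -> slope u v t != 0.
Proof.
move=> t0; rewrite mulf_neq0 ?invr_neq0 ?(gt_eqF (slope_den_gt0 _))//.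
apply/eqP => /J_sym0; rewrite linearD linearZ /= (J_sym0 uv) add0r Jxx.
by apply/eqP; rewrite mulf_neq0 ?expf_neq0 ?normr_eq0.
Qed.

(* [s := - (slope u v t)^-1] is the value for which [u + t v] is orthogonal to
   [u + s v]; symmetry then recovers [t] from [s]. *)
Lemma slope_polar t : t != 0 -> slope u v (- (slope u v t)^-1) = - t^-1.
Proof.
move=> t0; set s := - _.
have d0 r : J (u + r *: v) u != 0 by rewrite gt_eqF ?slope_den_gt0.
have : J (u + t *: v) (u + s *: v) = 0.
  rewrite linearD linearZ /= /s /slope.
  have := slopeN0 t0; rewrite /slope mulf_eq0 negb_or => /andP[n0 _].
  by field; rewrite d0 n0.
move=> /J_sym0; rewrite linearD linearZ /= addrC => /eqP; rewrite addr_eq0 => /eqP E.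
apply: (mulfI t0); rewrite mulrN divff// /slope mulrA E.
by rewrite mulNr divff.
Qed.

End Plane.

(* [J y v *: u - J y u *: v], with [y := x + c *: w], is orthogonal to both
   [y] and [w], hence to [x]. *)
Lemma J_ratio u v w x c : J w u = 0 -> J w v = 0 ->
  J (x + c *: w) v * J x u = J (x + c *: w) u * J x v.
Proof.
move=> wu wv; set y := x + _.
pose z := J y v *: u - J y u *: v.
have /J_sym0 : J y z = 0 by rewrite linearB /= !JrZ mulrC subrr.
have /J_sym0 zw : J w z = 0 by rewrite linearB /= !JrZ wu wv !mulr0 subrr.
rewrite linearD linearZ /= zw mulr0 addr0 => /J_sym0.
by rewrite linearB /= !JrZ => /eqP; rewrite subr_eq0 => /eqP.
Qed.

(** Dropping from [y] its component orthogonal to a coordinate plane keeps the ratio of the two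
    values in that plane ([J_ratio]), so all three slopes are quotients of [J y u], [J y v] and
    [J y w]. *)
Lemma slopeM u v w s t : u != 0 -> v != 0 -> w != 0 ->
  J u v = 0 -> J u w = 0 -> J v w = 0 -> s != 0 ->
  slope u w (s * t) = slope u v s * slope v w t.
Proof.
move=> u0 v0 w0 uv uw vw s0.
have [[vu wu] wv] := (J_sym0 uv, J_sym0 uw, J_sym0 vw).
set y := u + s *: v + (s * t) *: w.
have E12 := J_ratio (u + s *: v) (s * t) wu wv.
have E13 := J_ratio (u + (s * t) *: w) s vu vw.
have E23 := J_ratio (s *: (v + t *: w)) 1 uv uw.
rewrite addrAC -/y in E13; rewrite -/y in E12.
have yE : y = s *: (v + t *: w) + 1 *: u.
  by rewrite scale1r scalerDr scalerA [RHS]addrC addrA.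
rewrite -yE !JZ in E23.
have yu : J y u != 0.
  apply/eqP => /J_sym0; rewrite !linearD !linearZ /= uv uw !mulr0 !addr0 Jxx.
  by apply/eqP; rewrite expf_neq0// normr_eq0.
have yv : J y v != 0.
  apply/eqP => /J_sym0; rewrite !linearD !linearZ /= vu vw !mulr0 addr0 add0r Jxx.
  by apply/eqP; rewrite mulf_neq0// expf_neq0// normr_eq0.
have n1 : J (u + s *: v) u != 0 by rewrite gt_eqF ?slope_den_gt0.
have n2 : J (u + (s * t) *: w) u != 0 by rewrite gt_eqF ?slope_den_gt0.
have n3 : J (v + t *: w) v != 0 by rewrite gt_eqF ?slope_den_gt0.
have -> : slope u w (s * t) = J y w / J y u.
  by apply/eqP; rewrite /slope eqr_div// mulrC -E13 mulrC.
have -> : slope u v s = J y v / J y u.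
  by apply/eqP; rewrite /slope eqr_div// mulrC -E12 mulrC.
have -> : slope v w t = J y w / J y v.
  apply/eqP; rewrite /slope eqr_div// -(inj_eq (mulfI s0)).
  by rewrite [eqbRHS]mulrCA E23; apply/eqP; ring.
by field; rewrite yu yv.
Qed.

Lemma slope_linear u v w t : u != 0 -> v != 0 -> w != 0 ->
  J u v = 0 -> J u w = 0 -> J v w = 0 -> 0 < t ->
  slope u v t = slope u v 1 * t.
Proof.
move=> u0 v0 w0 uv uw vw t0.
set f := slope u v; pose k := f 1.
have k0 : 0 < k by apply: slope_gt0.
have g0 : slope v w 1 != 0 by rewrite gt_eqF// slope_gt0.
(* Four instances of [slopeM] through [w]. Negative arguments are allowed because [slope_polar]
   produces them. *)
have fM a b : a != 0 -> b != 0 -> k * f (a * b) = f a * f b.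
  move=> a0 b0.
  have E1 := slopeM 1 u0 v0 w0 uv uw vw (mulf_neq0 a0 b0).
  have E2 := slopeM b u0 v0 w0 uv uw vw a0.
  have E3 := slopeM 1 u0 v0 w0 uv uw vw b0.
  have E4 := slopeM b u0 v0 w0 uv uw vw (oner_neq0 R).
  rewrite !mulr1 in E1 E3; rewrite mul1r in E4.
  rewrite -/f -/k in E1 E2 E3 E4.
  apply: (mulIf g0); rewrite -mulrA -E1 E2 mulrCA -E4 E3.
  by rewrite mulrA.
have ft0 : 0 < f t by apply: slope_gt0.
set r := f t / k; have r0 : 0 < r by rewrite divr_gt0.
have ftE : f t = k * r by rewrite /r mulrC divfK// gt_eqF.
(* The involution: [fM] at [- (f t)^-1] and [r], whose product is [- k^-1]. By [slope_polar], [f]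
   takes the values [- t^-1] at [- (f t)^-1] and [- 1] at [- k^-1]. *)
have frE : f r = k * t.
  have := fM (- (f t)^-1) r.
  rewrite oppr_eq0 invr_eq0 !gt_eqF// => /(_ isT isT).
  rewrite [f (- _^-1)]slope_polar ?gt_eqF//.
  have -> : - (f t)^-1 * r = - k^-1 by rewrite /r; field; rewrite !gt_eqF.
  have /= := slope_polar u0 v0 uv (oner_neq0 R); rewrite -/f -/k => ->.
  rewrite invr1 mulrN1 mulNr => /oppr_inj E.
  by rewrite E mulrC mulrA divff ?mul1r// gt_eqF.
rewrite -/k -/f ftE; congr (k * _).
(* [f] maps [t] to [k * r] and [r] to [k * t], so a strict inequality between [t] and [r] would
   contradict monotonicity. *)
case: (ltgtP t r) => // [tr|rt].
  have := slope_le u0 v0 uv t0 (ltW tr); rewrite -/f ftE frE ler_pM2l//.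
  by rewrite leNgt tr.
have := slope_le u0 v0 uv r0 (ltW rt); rewrite -/f ftE frE ler_pM2l//.
by rewrite leNgt rt.
Qed.

(** * Planes in which the slope is linear *)

Section ConstantSlope.
Variables (u v : X) (k : R).
Hypotheses (u1 : `|u| = 1) (uv : J u v = 0) (k0 : 0 < k).
Hypothesis Jv : forall t, 0 < t -> J (u + t *: v) v = k * t * J (u + t *: v) u.

Let p t := J (u + t *: v) u.

Let u0 : u != 0. Proof. by rewrite -normr_eq0 u1 oner_neq0. Qed.

Let Jline s t : 0 <= t -> J (u + t *: v) (u + s *: v) = p t * (1 + k * t * s).
Proof.
rewrite le_eqVlt => /predU1P[<-|t0].
  by rewrite /p scale0r addr0 linearD linearZ /= uv; ring.
by rewrite linearD linearZ /= Jv// /p; ring.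
Qed.

Let p_gt0 t : 0 < p t. Proof. exact: slope_den_gt0. Qed.

Let norm_line t : 0 <= t -> `|u + t *: v| ^+ 2 = p t * (1 + k * t ^+ 2).
Proof. by move=> t0; rewrite -Jxx Jline// expr2 mulrA. Qed.

(** The bound [J_le] for the points of parameters [t] and [s], squared and divided by [p t]. *)
Let p_le s t : 0 <= s -> 0 <= t ->
  p t * (1 + k * t * s) ^+ 2 <= p s * ((1 + k * t ^+ 2) * (1 + k * s ^+ 2)).
Proof.
move=> s0 t0; rewrite -(ler_pM2l (p_gt0 t)).
have -> : p t * (p t * (1 + k * t * s) ^+ 2) = (p t * (1 + k * t * s)) ^+ 2 by ring.
have -> : p t * (p s * ((1 + k * t ^+ 2) * (1 + k * s ^+ 2))) =
    (`|u + t *: v| * `|u + s *: v|) ^+ 2 by rewrite exprMn !norm_line//; ring.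
have := J_le (u + t *: v) (u + s *: v); rewrite Jline// => le.
rewrite ler_pXn2r// nnegrE ?mulr_ge0// ?(ltW (p_gt0 t))//.
by rewrite addr_ge0 ?mulr_ge0 ?(ltW k0).
Qed.

(** Splitting the product in [p_le] as [(1 + k * b * a) ^+ 2 + k * (b - a) ^+ 2] bounds [p b - p a]
    by a multiple of [(b - a) ^+ 2], because [p] is bounded on [[0, t]]. *)
Lemma slope_den_eq1 t : 0 <= t -> p t = 1.
Proof.
move=> t0; have p0 : p 0 = 1 by rewrite /p scale0r addr0 Jxx u1 expr1n.
rewrite -p0; apply: (@eq_of_dist_le_sqr _ p ((1 + k * t ^+ 2) * k)) => // a b.
move=> /andP[a0 aT] /andP[b0 bT].
have pa : p a <= 1 + k * t ^+ 2.
  have := p_le (lexx 0) a0; rewrite p0 mulr0 addr0 expr1n mulr1 mul1r.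
  rewrite expr0n/= mulr0 addr0 mulr1 => /le_trans; apply.
  by rewrite lerD2l ler_pM2l// ler_pXn2r// nnegrE.
have := p_le a0 b0.
have -> : (1 + k * b ^+ 2) * (1 + k * a ^+ 2) = (1 + k * b * a) ^+ 2 + k * (b - a) ^+ 2.
  by ring.
rewrite [_ * (_ + _)]mulrDr -lerBlDl -mulrBl => le.
have [ba|ba] := leP (p b) (p a).
  apply: (@le_trans _ _ 0); rewrite ?subr_le0// mulr_ge0 ?sqr_ge0//.
  by rewrite mulr_ge0 ?(ltW k0)// addr_ge0// mulr_ge0 ?sqr_ge0// ltW.
apply: (@le_trans _ _ ((p b - p a) * (1 + k * b * a) ^+ 2)).
  rewrite ler_peMr ?subr_ge0 ?(ltW ba)// expr_ge1//.
    by rewrite lerDl !mulr_ge0// ltW.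
  by rewrite addr_ge0// !mulr_ge0// ltW.
by apply: le_trans le _; rewrite -mulrA; apply: ler_wpM2r pa; rewrite mulr_ge0 ?sqr_ge0// ltW.
Qed.

(** The squared norm of [u + t *: v] is [1 + k * t ^+ 2], and the triangle inequality puts it within
    [2 * t] of [1 + t ^+ 2]. The chosen [t] turns this into [3 * t <= 2 * t]. *)
Lemma slope_cst_eq1 : `|v| = 1 -> k = 1.
Proof.
move=> v1; apply/eqP; rewrite -subr_eq0 -normr_le0 leNgt; apply/negP => e0.
pose t := 3 / `|k - 1|; have t0 : 0 < t by rewrite divr_gt0.
have tv : `|t *: v| = t by rewrite normrZ v1 mulr1 gtr0_norm.
have := norm_line (ltW t0); rewrite slope_den_eq1 ?(ltW t0)// mul1r => N.
have := ler_normD u (t *: v); have := lerB_normD u (t *: v).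
rewrite u1 tv => le1 le2.
have := lerB_normD (t *: v) u; rewrite u1 tv [t *: v + u]addrC => le3.
have n0 := normr_ge0 (u + t *: v).
have tE : `|k - 1| * t = 3 by rewrite /t mulrC divfK ?gt_eqF.
move: N le1 le2 le3 n0; set n := `|u + _| => N le1 le2 le3 n0.
have : `|(k - 1) * t ^+ 2| <= 2 * t by rewrite ler_norml; apply/andP; split; nra.
rewrite normrM expr2 normrM (gtr0_norm t0) mulrA tE ler_pM2r//.
by rewrite ler_nat.
Qed.

End ConstantSlope.

(** * Symmetry of the duality map in dimension at least three *)

Section SymmetricDualityMap.
Hypothesis dim3 : (3 <= \dim {: X})%N.

(** A Gram-Schmidt step on a vector outside the span of [u] and [v]; it supplies the third direction
    for [slope_linear]. *)
Lemma exists_common_orth u v : u != 0 -> v != 0 -> J u v = 0 ->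
  exists w, [/\ w != 0, J u w = 0 & J v w = 0].
Proof.
move=> u0 v0 uv.
have /subvPn[z _ zN] : ~~ ({: X} <= <<[:: u; v]>>)%VS.
  apply/negP => /dimvS; apply/negP; rewrite -ltnNge.
  by apply: leq_ltn_trans (dim_span _) _.
exists (z - ((J u z / `|u| ^+ 2) *: u + (J v z / `|v| ^+ 2) *: v)).
have nu : `|u| ^+ 2 != 0 by rewrite expf_neq0 ?normr_eq0.
have nv : `|v| ^+ 2 != 0 by rewrite expf_neq0 ?normr_eq0.
split.
- apply: contraNneq zN => /eqP; rewrite subr_eq0 => /eqP ->.
  by rewrite rpredD// rpredZ// memv_span// !inE eqxx ?orbT.
- by rewrite linearB linearD /= !JrZ uv mulr0 addr0 Jxx divfK// subrr.
- by rewrite linearB linearD /= !JrZ (J_sym0 uv) mulr0 add0r Jxx divfK// subrr.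
Qed.

Lemma J_orthonormal_pos u v t : `|u| = 1 -> `|v| = 1 -> J u v = 0 -> 0 < t ->
  J (u + t *: v) u = 1.
Proof.
move=> u1 v1 uv t0.
have u0 : u != 0 by rewrite -normr_eq0 u1 oner_neq0.
have v0 : v != 0 by rewrite -normr_eq0 v1 oner_neq0.
have [w [w0 uw vw]] := exists_common_orth u0 v0 uv.
have k0 : 0 < slope u v 1 by apply: slope_gt0.
apply: (slope_den_eq1 u1 uv k0) (ltW t0) => r r0.
by rewrite -(slope_linear u0 v0 w0 uv uw vw r0) /slope divfK ?gt_eqF ?slope_den_gt0.
Qed.

Lemma J_orthonormal u v a b : `|u| = 1 -> `|v| = 1 -> J u v = 0 ->
  a != 0 -> 0 < b -> J (a *: u + b *: v) u = a.
Proof.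
move=> u1 v1 uv a0 b0.
have [a_gt0|a_lt0|/eqP] := ltgtP 0 a; last by rewrite eq_sym (negPf a0).
  have -> : a *: u + b *: v = a *: (u + (b / a) *: v).
    by rewrite scalerDr scalerA mulrC divfK.
  by rewrite JZ J_orthonormal_pos ?mulr1 ?divr_gt0.
(* For negative [a], the orthonormal pair [- u], [v] is used instead. *)
have -> : a *: u + b *: v = (- a) *: (- u + (b / - a) *: v).
  by rewrite scalerDr scalerA mulrC divfK ?oppr_eq0// scalerN scaleNr opprK.
rewrite JZ -[in X in _ * J _ X](opprK u) linearN /= mulrNN.
rewrite J_orthonormal_pos ?mulr1 ?normrN ?divr_gt0 ?oppr_gt0//.
by rewrite -scaleN1r JZ uv mulr0.
Qed.

Lemma J_sym x y : J x y = J y x.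
Proof.
have [->|x0] := eqVneq x 0; first by rewrite J0 linear0.
have nx0 : `|x| != 0 by rewrite normr_eq0.
pose u := `|x|^-1 *: x.
have u1 : `|u| = 1 by rewrite normrZ normfV normr_id mulVf.
have xE : x = `|x| *: u by rewrite scalerA divff// scale1r.
pose a := J u y; pose z := y - a *: u.
have yE : y = a *: u + z by rewrite addrC subrK.
have uz : J u z = 0 by rewrite linearB /= JrZ Jxx u1 expr1n mulr1 subrr.
(* Homogeneity on the left and linearity on the right both extract the norm of [x]. *)
suff yu : J y u = a by rewrite [in LHS]xE [in RHS]xE JZ JrZ yu.
have [a0|a0] := eqVneq a 0; first by rewrite a0 (J_sym0 a0).
have [z0|z0] := eqVneq z 0.
  by rewrite yE z0 addr0 JZ Jxx u1 expr1n mulr1.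
have nz0 : `|z| != 0 by rewrite normr_eq0.
have zE : z = `|z| *: (`|z|^-1 *: z) by rewrite scalerA divff// scale1r.
rewrite yE zE J_orthonormal ?normr_gt0//.
  by rewrite normrZ normfV normr_id mulVf.
by rewrite JrZ uz mulr0.
Qed.

End SymmetricDualityMap.

End DualityMap.

(** * Approximation and Birkhoff-James orthogonality *)

Section Approximation.
Variables (R : realType) (X : normedVectType R).

Lemma dual_norm1_le (f : {scalar X}) (y : X) : dual_norm f = 1 -> `|f y| <= `|y|.
Proof.
move=> f1; have [->|y0] := eqVneq y 0; first by rewrite linear0 !normr0.
set A := [set `|f y| | y in [set y : X | `|y| <= 1]].
have hsA : has_sup A.
  apply: contrapT => /sup_out; rewrite -/(dual_norm f) f1 => /eqP.
  by rewrite oner_eq0.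
have ny : `|y| != 0 by rewrite normr_eq0.
have : A `|f (`|y|^-1 *: y)|.
  by exists (`|y|^-1 *: y) => //=; rewrite normrZ normfV normr_id mulVf.
move=> /(ub_le_sup hsA.2); rewrite -/(dual_norm f) f1 linearZ /= normrM normfV normr_id.
by rewrite ler_pdivrMl ?mulr1 ?normr_gt0.
Qed.

Definition bj_orth (x y : X) := forall t : R, `|x| <= `|x + t *: y|.

Lemma norming_bj_orth (x y : X) (f : {scalar X}) : norming x f -> f y = 0 -> bj_orth x y.
Proof.
move=> [f1 fx] fy t; rewrite -fx.
have -> : f x = f (x + t *: y) by rewrite linearD linearZ /= fy mulr0 addr0.
exact: le_trans (ler_norm _) (dual_norm1_le _ f1).
Qed.

Lemma bj_orth_coapproximation (x y : X) c : bj_orth y (x - c *: y) ->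
  best_coapproximation x <[y]>%VS (c *: y).
Proof.
move=> yx; split; first by rewrite memvZ ?memv_line.
move=> _ /vlineP[d ->]; rewrite -scalerBl.
have [->|cd] := eqVneq c d; first by rewrite subrr scale0r normr0.
have cd0 : c - d != 0 by rewrite subr_eq0.
have -> : x - d *: y = (c - d) *: (y + (c - d)^-1 *: (x - c *: y)).
  by rewrite scalerDr scalerA divff// scale1r scalerBl [RHS]addrC addrA subrK.
by rewrite !normrZ ler_wpM2l.
Qed.

Section CoincidingApproximations.
Hypothesis coincide : forall (x0 : X) (G : {vspace X}), \dim G = 1%N ->
  exists w0 : X, best_coapproximation x0 G = [set w0] /\
                 best_approximation x0 G = [set w0].

(** Orthogonality of [x] to [y] makes 0 a best coapproximation to [y] out of the line of [x]; as a
    best approximation, 0 says that [y] is orthogonal to [x]. *)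
Lemma bj_orth_sym (x y : X) : x != 0 -> bj_orth x y -> bj_orth y x.
Proof.
move=> x0 xy t.
have [|w [cw bw]] := @coincide y <[x]>%VS; first by rewrite dim_vline x0.
have : best_coapproximation y <[x]>%VS (0 *: x).
  by apply: bj_orth_coapproximation; rewrite scale0r subr0.
rewrite cw scale0r /= => w0.
have : best_approximation y <[x]>%VS 0 by rewrite bw w0.
move=> [_ /(_ (- t *: x))]; rewrite subr0 scaleNr opprK; apply.
by rewrite rpredN memvZ ?memv_line.
Qed.

(** Both 0 and [(f y / |x|) *: x] are best coapproximations to [y] out of the line of [x];
    uniqueness forces [f y = 0]. *)
Lemma bj_orth_norming (x y : X) (f : {scalar X}) : x != 0 -> norming x f ->
  bj_orth x y -> f y = 0.
Proof.
move=> x0 fx xy; have nx0 : `|x| != 0 by rewrite normr_eq0.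
have [|w [cw _]] := @coincide y <[x]>%VS; first by rewrite dim_vline x0.
have : best_coapproximation y <[x]>%VS (0 *: x).
  by apply: bj_orth_coapproximation; rewrite scale0r subr0.
have : best_coapproximation y <[x]>%VS ((f y / `|x|) *: x).
  apply: bj_orth_coapproximation; apply: (norming_bj_orth fx).
  by rewrite linearB linearZ /= fx.2 divfK ?subrr.
rewrite cw /= scale0r => <- /esym/eqP.
by rewrite scaler_eq0 (negPf x0) orbF mulf_eq0 invr_eq0 (negPf nx0) orbF => /eqP.
Qed.

Lemma coincide_inner_product_space : (3 <= \dim {: X})%N -> smooth X ->
  inner_product_space X.
Proof.
move=> dim3 smX.
have /boolp.choice[f fP] (x : X) : exists f : {scalar X}, x != 0 -> norming x f.
  have [->|x0] := eqVneq x 0; first by exists (\0 : {scalar X}).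
  by have [f [fx _]] := smX x x0; exists f.
pose J x : {scalar X} := `|x| \*o f x.
have Jxx x : J x x = `|x| ^+ 2.
  have [->|x0] := eqVneq x 0; first by rewrite /= normr0 mul0r expr0n.
  by rewrite /= (fP _ x0).2 expr2.
have J_le x y : J x y <= `|x| * `|y|.
  have [->|x0] := eqVneq x 0; first by rewrite /= normr0 !mul0r.
  rewrite /= ler_wpM2l//; apply: le_trans (ler_norm _) _.
  exact: dual_norm1_le (fP _ x0).1.
have J_sym0 x y : J x y = 0 -> J y x = 0.
  have [->|x0] := eqVneq x 0; first by rewrite linear0.
  have [->|y0] := eqVneq y 0; first by rewrite /= normr0 mul0r.
  move=> /= /eqP; rewrite mulf_eq0 normr_eq0 (negPf x0) /= => /eqP fxy.
  rewrite (bj_orth_norming y0 (fP _ y0)) ?mulr0//.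
  by apply: bj_orth_sym => //; apply: norming_bj_orth (fP _ x0) fxy.
have [x x0|B BJ] := dot_of_scalar (J_sym Jxx J_le J_sym0 dim3).
  by rewrite Jxx exprn_gt0 ?normr_gt0.
by exists B => x; rewrite BJ Jxx sqrtr_sqr normr_id.
Qed.

End CoincidingApproximations.

(** * Orthogonal projection in inner product spaces *)

Lemma inner_product_coincide : inner_product_space X ->
  forall (x0 : X) (G : {vspace X}), \dim G = 1%N ->
  exists w0 : X, best_coapproximation x0 G = [set w0] /\
                 best_approximation x0 G = [set w0].
Proof.
move=> [B normB] x0 G G1.
have B_ge0 x : 0 <= B x x.
  have [->|/neq0_dnorm_gt0/ltW//] := eqVneq x 0; by rewrite linear0r.
have Bxx x : B x x = `|x| ^+ 2 by rewrite normB sqr_sqrtr.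
have Bsym x y : B x y = B y x by rewrite hermC expr0 mul1r.
have G0 : G != 0%VS by rewrite -dimv_eq0 G1.
pose e := vpick G; have e0 : e != 0 by rewrite vpick0.
have -> : G = <[e]>%VS.
  by apply/esym/eqP; rewrite eqEdim -memvE memv_pick dim_vline e0 G1.
have E0 : 0 < B e e by apply: neq0_dnorm_gt0.
pose c := B e x0 / B e e.
have [z zE ez] : exists2 z, x0 = c *: e + z & B e z = 0.
  exists (x0 - c *: e); first by rewrite addrC subrK.
  by rewrite linearBr linearZr_LR /= divfK ?gt_eqF// subrr.
have pyth a : `|a *: e + z| ^+ 2 = a ^+ 2 * B e e + B z z.
  rewrite -Bxx linearDl !linearDr /= !linearZl_LR !linearZr_LR /= [B z e]Bsym ez.
  ring.
have lineE a : `|a *: e| ^+ 2 = a ^+ 2 * B e e.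
  by rewrite normrZ exprMn real_normK ?num_real// Bxx.
have x0E a : x0 - a *: e = (c - a) *: e + z.
  by rewrite zE scalerBl addrAC.
have nle (x y : X) : (`|x| <= `|y|) = (`|x| ^+ 2 <= `|y| ^+ 2).
  by rewrite ler_pXn2r// nnegrE.
exists (c *: e); split; apply/seteqP; split => x /=.
- move=> [/vlineP[d ->] H].
  have {}H s : (d - (c - s)) ^+ 2 * B e e <= s ^+ 2 * B e e + B z z.
    have := H ((c - s) *: e); rewrite memvZ ?memv_line// => /(_ isT).
    by rewrite -scalerBl x0E nle lineE pyth opprB [c + _]addrC subrK.
  apply: contrapT => cd.
  have dc : d - c != 0 by rewrite subr_eq0; apply/eqP => dc; apply: cd; rewrite dc.
  (* The terms in [s ^+ 2] cancel in [H], and this [s] makes the cross term equal to [B z z],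
     leaving [(d - c) ^+ 2 * B e e <= 0]. *)
  have := H (B z z / (2 * (d - c) * B e e)); set s := _ / _.
  have sE : 2 * (d - c) * s * B e e = B z z.
    by rewrite /s; field; rewrite dc gt_eqF.
  have : 0 < (d - c) ^+ 2 * B e e by rewrite mulr_gt0// exprn_even_gt0.
  rewrite -sE; nra.
- move=> ->; split; first by rewrite memvZ ?memv_line.
  move=> _ /vlineP[a ->]; rewrite -scalerBl x0E nle lineE pyth.
  by rewrite lerDl.
- move=> [/vlineP[d ->] /(_ (c *: e))]; rewrite memvZ ?memv_line// => /(_ isT).
  rewrite !x0E nle !pyth subrr expr0n mul0r lerD2r => le.
  have : (c - d) ^+ 2 <= 0 by rewrite -(ler_pM2r E0) mul0r.
  by rewrite le_eqVlt ltNge sqr_ge0 orbF sqrf_eq0 subr_eq0 => /eqP ->.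
- move=> ->; split; first by rewrite memvZ ?memv_line.
  move=> _ /vlineP[a ->]; rewrite !x0E nle !pyth subrr expr0n mul0r.
  by rewrite lerD2r mulr_ge0 ?sqr_ge0// ltW.
Qed.

End Approximation.

Theorem theorem2p4 (R : realType) (X : normedVectType R) :
  (3 <= \dim {: X})%N -> smooth X -> strictly_convex X ->
  (inner_product_space X <->
   forall (x0 : X) (G : {vspace X}), \dim G = 1%N ->
     exists w0 : X,
       best_coapproximation x0 G = [set w0] /\
       best_approximation x0 G = [set w0]).
Proof.
move=> dim3 smX _; split; first exact: inner_product_coincide.
by move=> coincide; apply: coincide_inner_product_space.
Qed.
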